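(* Let $M$ be a nonempty compact manifold of dimension at least $1$, with a compatible metric $\operatorname{dist}$, and let $f:M\to M$ be a homeomorphism. Then for all $\epsilon>0$ there are an $\epsilon$-dense Cantor set $K\subset M$ and a homeomorphism $g:K\to K$ conjugate to the Special Homeomorphism such that $\operatorname{dist}_{C^0}(g,f|_K)<\epsilon$.
   Context: A Cantor set (Cantor space) is a (nonempty) compact, perfect (no isolated points), totally disconnected metric space. $K\subset M$ is $\epsilon$-dense if every point of $M$ is at distance less than $\epsilon$ from some point of $K$. For $g:K\to K\subset M$ and $f|_K:K\to M$, $\operatorname{dist}_{C^0}(g,f|_K)=\sup_{x\in K}\operatorname{dist}(g(x),f(x))$. Two homeomorphisms $u:X\to X$ and $v:Y\to Y$ are (topologically) conjugate if there is a homeomorphism $\varphi:X\to Y$ with $v\varphi=\varphi u$. Special Homeomorphism: for a Cantor space $C$, let $H(C)$ be the group of homeomorphisms of $C$ with the $C^0$ (uniform convergence) topology, which is Polish. By a theorem of Kechris and Rosendal (see also Akin, Glasner and Weiss), there is a conjugacy class in $H(C)$ that is a dense $G_\delta$ subset of $H(C)$; by the Baire category theorem it is unique. The Special Homeomorphism is any element of this class (well defined up to topological conjugacy, and independent of $C$, since all Cantor spaces are homeomorphic). *)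

(* Defs.v *)
From mathcomp Require Import all_boot all_order all_algebra.
From mathcomp Require Import all_classical all_reals all_analysis.
From mathcomp Require Import borel_hierarchy.

Set Implicit Arguments.
Unset Strict Implicit.
Unset Printing Implicit Defensive.

Import Order.TTheory GRing.Theory Num.Theory.
Import numFieldNormedType.Exports.

Local Open Scope classical_set_scope.
Local Open Scope ring_scope.

(* Maps between subspaces A and B are total functions T -> U; their values
   outside A are irrelevant, and continuity is for the subspace topologies. *)
Definition homeomorphism_on (T U : topologicalType) (A : set T) (B : set U)
    (f : T -> U) : Prop :=
  {within A, continuous f} /\
  exists g : U -> T,
    [/\ {within B, continuous g},
        (forall x, A x -> B (f x)),
        (forall y, B y -> A (g y)),
        (forall x, A x -> g (f x) = x) &
        (forall y, B y -> f (g y) = y)].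

Definition conjugate_on (T U : topologicalType) (A : set T) (B : set U)
    (u : T -> T) (v : U -> U) : Prop :=
  exists phi : T -> U,
    homeomorphism_on A B phi /\ forall x, A x -> v (phi x) = phi (u x).

Definition cantor_set (T : topologicalType) (K : set T) : Prop :=
  [/\ K !=set0, compact K, perfect_set K & totally_disconnected K].

(* The type {uniform C -> C} carries the topology of uniform convergence; the
   homeomorphism group is handled as a subset of it, so that its topology is
   the induced one. *)
Definition homeo_group (C : uniformType) : set {uniform C -> C} :=
  [set h : {uniform C -> C} | homeomorphism_on [set: C] [set: C] h].

Definition conjugacy_class (C : uniformType) (s : C -> C) :
    set {uniform C -> C} :=
  [set h : {uniform C -> C} |
    homeo_group h /\ conjugate_on [set: C] [set: C] h s].

(* Density and being G_delta are relative to homeo_group C. *)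
Definition special_homeomorphism (C : uniformType) (s : C -> C) : Prop :=
  [/\ homeomorphism_on [set: C] [set: C] s,
      homeo_group (C := C) `<=` closure (conjugacy_class s) &
      exists2 G : set {uniform C -> C},
        Gdelta G & conjugacy_class s = homeo_group (C := C) `&` G].

(* For n = 0 there is no coordinate and this is the whole one-point space. *)
Definition half_space (R : realType) (n : nat) : set 'rV[R]_n :=
  [set x | forall i : 'I_n, nat_of_ord i = 0%N -> 0 <= x ord0 i].

(* Charts are modelled on the half-space: the boundary may be empty or not. *)
Definition manifold (R : realType) (n : nat) (M : topologicalType) : Prop :=
  [/\ hausdorff_space M, @second_countable M &
      forall p : M, exists (U : set M) (V : set 'rV[R]_n) (phi : M -> 'rV[R]_n),
        [/\ open U, U p, open V &
            homeomorphism_on U (half_space (R := R) (n := n) `&` V) phi]].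

Definition eps_dense (R : realType) (M : metricType R) (eps : R) (K : set M) :
    Prop :=
  forall x : M, exists2 y, K y & mdist x y < eps.

Definition dist_C0 (R : realType) (M : metricType R) (K : set M)
    (g f : M -> M) : R :=
  sup [set mdist (g x) (f x) | x in K].

(* Main.v *)
Require Import Defs.
From HB Require Import structures.
From mathcomp Require Import all_boot all_order all_algebra finmap.
From mathcomp Require Import all_classical all_reals all_analysis.
From mathcomp Require Import borel_hierarchy.
From mathcomp Require Import ring lra.

Import Order.TTheory GRing.Theory Num.Theory.
Import numFieldNormedType.Exports.

Local Open Scope classical_set_scope.
Local Open Scope ring_scope.

Set Implicit Arguments.
Unset Strict Implicit.
Unset Printing Implicit Defensive.

(** Points of [M] need not be nearly recurrent under [f], so in general no
    permutation of a finite set follows [f]; but a finite directed graph does.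
    Choose a fine finite net [P] in [M] and join [p] to [q] by an edge when
    [f p] is close to [q]. As [f] is onto and uniformly continuous, every vertex
    has an edge leaving it and an edge entering it ([finite_model]).

    On a Cantor space [C], such a graph is realised by a homeomorphism.
    Partition [C] into one nonempty clopen piece per edge. The pieces of the
    edges entering [p] form a nonempty clopen set, the pieces of the edges
    leaving [p] form another one, and any two nonempty clopen subsets of a
    Cantor space are homeomorphic, by Brouwer's characterisation. Gluing these
    homeomorphisms over all [p] gives [h : C -> C] which moves the points along
    the edges ([graph_homeomorphism]).

    The map [pi : C -> P] taking a point to the source of its edge is locally
    constant, so any [S'] uniformly close to [h] satisfies
    [pi (S' c) = pi (h c)]. The conjugacy class of the Special
    Homeomorphism being dense, [S'] can be taken in it
    ([dense_conjugate_locally_constant]).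

    Finally [pi] is perturbed to an embedding [i : C -> M]: every
    neighbourhood of a point of a manifold of positive dimension contains an
    arc, hence a copy of [C], and putting the fibre of [pi] over [p] in such
    a copy close to [p] does it ([cantor_embedding_near]). The set [K] is the
    image of [i] and [g] is [S'] transported by [i]: since [i c] is close to
    [pi c] and [pi (S' c)] is close to [f (pi c)], [g] is close to [f] on
    [K]. *)

(** * Compact totally disconnected spaces *)

(** In a compact Hausdorff space the connected component of [x] is the
    intersection [Q] of the clopen sets containing [x]. Indeed a clopen part
    [B] of [Q] has an open neighbourhood [U] whose boundary misses [Q]; by
    compactness some clopen [W] containing [x] already misses that boundary,
    so that [U] cuts [W] into two clopen pieces, one of which contains [Q]. *)
Lemma compact_totally_disconnected_zero_dimensional (T : topologicalType) :
  hausdorff_space T -> compact [set: T] -> totally_disconnected [set: T] ->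
  zero_dimensional T.
Proof.
move=> hT cT tdT x y xy.
pose Q := \bigcap_(W in [set W : set T | clopen W /\ W x]) W.
suff /existsNP[W /not_implyP[[cW Wx] Wy]] : ~ Q y by exists W.
have Qx : Q x by move=> W [].
have clQ : closed Q by apply: closed_bigI => W [[]].
suff conQ : connected Q.
  move=> Qy; have : connected_component [set: T] x y by exists Q.
  by rewrite (tdT x I) => yx; move: xy; rewrite yx eqxx.
move=> B B0 [A oA BA] [D cD BD].
have clB : closed B by rewrite BD; exact: closedI.
have nB : set_nbhs B (~` (Q `\` A)).
  move=> z; rewrite BA => -[Qz Az]; apply: open_nbhs_nbhs; split; last by case.
  apply: closed_openC; rewrite setDE; apply: closedI => //.
  exact: open_closedC.
have [V nV clV] := compact_normal hT cT clB nB; pose U := interior V.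
have oU : open U by exact: open_interior.
have BU : B `<=` U by exact: nV.
have QU z : Q z -> closure U z -> B z.
  move=> Qz /(closureS (@interior_subset _ V))/clV/not_andP[//|].
  by rewrite BA => /contrapT.
(* Otherwise the traces of the clopen sets on the boundary of [U] generate a
   proper filter, and its cluster points lie in [Q]. *)
have [W [cW Wx WU]] : exists W, [/\ clopen W, W x &
    W `&` (closure U `\` U) = set0].
  apply: contrapT => nW.
  pose G := filter_from [set W : set T | clopen W /\ W x]
    (fun W => W `&` (closure U `\` U)).
  have GG : ProperFilter G.
    apply: filter_from_proper.
      apply: filter_from_filter.
        by exists setT; split => //; exact: clopenT.
      move=> W W' [? ?] [? ?]; exists (W `&` W').
        by split=> //; exact: clopenI.
      by move=> z [[? ?] ?].
    by move=> W [cW Wx]; apply/set0P/eqP => e; apply: nW; exists W.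
  have GC : closed (closure U `\` U) by rewrite setDE; apply: closedI;
    [exact: closed_closure|exact: open_closedC].
  have [] := subclosed_compact GC cT (@subsetT _ _) (F := G).
    by exists setT => //; split => //; exact: clopenT.
  move=> z [[Uz nUz] zG]; apply: nUz; apply: BU; apply: QU => // W [cW Wx].
  apply: (cW.2) => N Nz.
  have GW : G (W `&` (closure U `\` U)) by exists W.
  by have [t [[Wt _] Nt]] := zG _ _ GW Nz; exists t.
have clWU : clopen (W `&` U).
  split; first by apply: openI => //; case: cW.
  suff -> : W `&` U = W `&` closure U.
    by apply: closedI; [case: cW|exact: closed_closure].
  apply/seteqP; split => [z [? ?]|z [Wz Uz]].
    by split=> //; exact: subset_closure.
  split => //; apply: contrapT => nUz.
  by have : (W `&` (closure U `\` U)) z by []; rewrite WU.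
apply/seteqP; split; first by rewrite BA => z [].
have [Bx|nBx] := pselect (B x).
  move=> z Qz; apply: QU => //; apply: subset_closure.
  by have [] := Qz (W `&` U) (conj clWU (conj Wx (BU _ Bx))).
move=> z Qz; case: B0 => b Bb; have Qb : Q b by move: Bb; rewrite BA => -[].
suff WUx : (W `&` ~` (W `&` U)) x.
  have [Wb /not_andP[//|]] : (W `&` ~` (W `&` U)) b.
    by apply: Qb; split=> //; apply: clopenI => //; exact: clopenC.
  by move/(_ (BU _ Bb)).
split => // -[_ Ux]; apply: nBx; apply: QU => //; exact: subset_closure.
Qed.

Lemma cantor_set_cantor_like (T : topologicalType) :
  hausdorff_space T -> cantor_set [set: T] -> cantor_like T.
Proof.
move=> hT [_ cT pT tdT]; split => //.
exact: compact_totally_disconnected_zero_dimensional.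
Qed.

(** * Homeomorphisms between subspaces *)

Lemma homeomorphism_onT (T U : topologicalType) (u : T -> U) (v : U -> T) :
  continuous u -> continuous v -> cancel u v -> cancel v u ->
  homeomorphism_on [set: T] [set: U] u.
Proof.
move=> cu cv uK vK; split; first exact/(continuous_subspace_setT u).
by exists v; split => //; apply/(continuous_subspace_setT v).
Qed.

Lemma within_comp (T U V : topologicalType) (A : set T) (B : set U)
    (f : T -> U) (g : U -> V) :
  {within A, continuous f} -> {within B, continuous g} ->
  (forall x, A x -> B (f x)) -> {within A, continuous (g \o f)}.
Proof.
move=> /subspace_continuousP cf /subspace_continuousP cg AB.
apply/subspace_continuousP => x Ax; apply: cvg_comp (cg _ (AB _ Ax)) => N /=.
move=> /(cf _ Ax); rewrite !nbhs_simpl /within /=.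
by apply: filterS => t Nt At; exact: Nt At (AB _ At).
Qed.

Lemma homeomorphism_on_comp (T U V : topologicalType) (A : set T) (B : set U)
    (D : set V) (f : T -> U) (g : U -> V) :
  homeomorphism_on A B f -> homeomorphism_on B D g ->
  homeomorphism_on A D (g \o f).
Proof.
move=> [cf [f' [cf' fB f'A fK f'K]]] [cg [g' [cg' gD g'B gK g'K]]].
split; first exact: within_comp cg fB.
exists (f' \o g'); split => /=.
- exact: within_comp cf' g'B.
- by move=> x /fB/gD.
- by move=> x /g'B/f'A.
- by move=> x Ax; rewrite gK ?fK//; exact: fB.
- by move=> x Dx; rewrite f'K ?g'K//; exact: g'B.
Qed.

Lemma continuous_within_comp (T U V : topologicalType) (B : set U)
    (f : T -> U) (g : U -> V) :
  continuous f -> {within B, continuous g} -> (forall x, B (f x)) ->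
  continuous (g \o f).
Proof.
move=> cf cg fB; apply/(continuous_subspace_setT (g \o f)).
by apply: within_comp cg _ => //; apply/(continuous_subspace_setT f).
Qed.

(** * Clopen subsets of a Cantor space *)

(** The base point [x] is recorded in the type, so that results about pointed
    spaces apply to a space that is only known to be nonempty. *)
Definition pointed_at (T : Type) (x : T) : Type := T.
HB.instance Definition _ (R : realType) (T : pseudoMetricType R) (x : T) :=
  PseudoMetric.on (pointed_at x).
HB.instance Definition _ (R : realType) (T : pseudoMetricType R) (x : T) :=
  isPointed.Build (pointed_at x) x.

Lemma cantor_like_homeomorphic (R : realType) (T : pseudoMetricType R) :
  [set: T] !=set0 -> cantor_like T ->
  exists (u : cantor_space -> T) (v : T -> cantor_space),
    [/\ continuous u, continuous v, cancel u v & cancel v u].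
Proof.
move=> [x _] clT.
have [u [cu closed_u]] :=
  @homeomorphism_cantor_like R (pointed_at x : pseudoPMetricType R) clT.
have uK : cancel u u^-1%FUN by move=> b; apply: funK; rewrite inE.
have vK : cancel u^-1%FUN u by move=> y; apply: invK; rewrite inE.
exists u, u^-1%FUN; split => //; apply/continuous_closedP => A /closed_u.
suff -> : u @` A = u^-1%FUN @^-1` A by [].
apply/seteqP; split => [_ [a Aa <-]|y Ay]; first by rewrite /preimage /= uK.
by exists (u^-1%FUN y).
Qed.

Lemma valL_set_val (T U : Type) (A : set T) (y : U) (f : A -> U) (x : A) :
  'valL_y f (set_val x) = f x.
Proof. exact: (congr1 (@^~ x) (valLK y f)). Qed.

Definition cantor_chart (T : topologicalType) (A : set T)
    (u : cantor_space -> T) (v : T -> cantor_space) : Prop :=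
  [/\ continuous u, {within A, continuous v}, forall b, A (u b),
      cancel u v & forall x, A x -> u (v x) = x].

(** With its subspace topology, [A] is again a Cantor space: it is compact
    because [A] is closed, and an isolated point of it would be isolated in [T]
    because [A] is open. *)
Lemma clopen_homeomorphic_cantor (R : realType) (T : pseudoMetricType R)
    (A : set T) :
  cantor_like T -> clopen A -> A !=set0 ->
  exists (u : cantor_space -> T) (v : T -> cantor_space), cantor_chart A u v.
Proof.
move=> [pT cT hT zT] [oA clA] [a Aa].
have cA : compact A by apply: subclosed_compact clA cT _.
have valc : continuous (set_val : A -> T) by exact: initial_continuous.
have clsA : cantor_like (set_type A).
  split.
  - apply/perfectTP => x [W oW Wx].
    move/perfectTP: pT => /(_ (set_val x)); apply.
    suff <- : W `&` A = [set set_val x] by exact: openI.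
    apply/seteqP; split => [y [Wy Ay]|_ ->]; last first.
      by split; [have : [set x] x by []; rewrite -Wx|exact: set_valP].
    have : [set x] (SigSub (mem_set Ay)) by rewrite -Wx.
    by move=> /= <-.
  - suff <- : 'valL_(SigSub (mem_set Aa) : A) id @` A = [set: A].
      apply: continuous_compact cA; apply/subspace_valL_continuousP' => x.
      exact: cvg_id.
    apply/seteqP; split => // x _; exists (set_val x); first exact: set_valP.
    by rewrite valL_set_val.
  - move=> x y xy; apply: val_inj; apply: hT => N N' Nx Ny.
    have [z [Nz N'z]] := xy _ _ (valc _ _ Nx) (valc _ _ Ny).
    by exists (set_val z).
  - move=> x y xy; have : set_val x != set_val y by [].
    move=> /zT [W [[oW cW] Wx Wy]]; exists (set_val @^-1` W); split => //.
    split; first exact: open_comp.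
    exact: preimage_closed.
have [u [v [cu cv uK vK]]] := @cantor_like_homeomorphic R A
  (ex_intro _ (SigSub (mem_set Aa)) I) clsA.
exists (set_val \o u), ('valL_point v); split.
- by move=> b; apply: continuous_comp; [exact: cu|exact: valc].
- exact/subspace_valL_continuousP'.
- by move=> b; exact: set_valP.
- by move=> b; exact: etrans (valL_set_val _ _ _) (uK b).
- move=> x Ax; have vx := valL_set_val point v (SigSub (mem_set Ax)).
  by apply: etrans (congr1 (set_val \o u) vx) _; rewrite /= vK.
Qed.

(** * Realising a finite graph by a homeomorphism *)

(** Locally constant maps are used instead of continuous maps into a discrete
    space, so that finite index types need no topology. *)
Definition locally_constant (T : topologicalType) (P : Type) (f : T -> P) :=
  forall x, \forall y \near x, f y = f x.

Lemma locally_constant_comp (T : topologicalType) (P Q : Type) (f : T -> P)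
  (k : P -> Q) : locally_constant f -> locally_constant (k \o f).
Proof. by move=> lf x; apply: filterS (lf x) => y /= ->. Qed.

Lemma locally_constant_precomp (T U : topologicalType) (P : Type) (v : T -> U)
  (f : U -> P) :
  continuous v -> locally_constant f -> locally_constant (f \o v).
Proof. by move=> cv lf x; exact: cv _ _ (lf (v x)). Qed.

Lemma locally_constant_fiber_clopen (T : topologicalType) (P : Type)
  (f : T -> P) (p : P) : locally_constant f -> clopen [set x | f x = p].
Proof.
move=> lf; have op (S : set P) : open [set x | S (f x)].
  by rewrite openE => x /= Sx; apply: filterS (lf x) => y /= ->.
split; first exact: op [set p].
by rewrite -openC; exact: op (~` [set p]).
Qed.

Lemma glue_continuous (T U : topologicalType) (P : Type) (f : T -> P)
  (F : P -> T -> U) :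
  locally_constant f ->
  (forall p, {within [set x | f x = p], continuous (F p)}) ->
  continuous (fun x => F (f x) x).
Proof.
move=> lf cF x N Nx.
have /subspace_continuousP/(_ x erefl N Nx) := cF (f x).
rewrite !nbhs_simpl /within /= => H.
by apply: filterS2 H (lf x) => y Hy fy; rewrite /= fy; exact: Hy.
Qed.

Lemma cantor_space_prefix (b : cantor_space) (n : nat) :
  \forall c \near b, forall i, (i < n)%N -> c i = b i.
Proof.
elim: n => [|n IH]; first by near=> c.
have bn : \forall c \near b, c n = b n.
  exact: (@proj_continuous nat (fun=> bool) n b [set b n]) (discrete_set1 _).
apply: filterS2 IH bn => c cb cn i; rewrite ltnS leq_eqVlt => /orP[/eqP ->//|].
exact: cb.
Unshelve. all: by end_near. Qed.

(** The position of the first nonzero bit depends on finitely many bits only and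
    takes every value. *)
Lemma cantor_space_onto_finType (E : finType) (e0 : E) :
  exists f : cantor_space -> E,
    locally_constant f /\ forall e, exists b, f b = e.
Proof.
(* When the first [#|E|] bits all vanish the default [e0] is returned. *)
pose f (b : cantor_space) :=
  nth e0 (enum E) (find id [seq b i | i <- iota 0 #|E|]).
exists f; split=> [b|e].
  apply: filterS (cantor_space_prefix b #|E|) => c cb; rewrite /f.
  congr (nth _ _ (find _ _)); apply/eq_in_map => i.
  by rewrite mem_iota /= add0n; exact: cb.
have lte : (index e (enum E) < #|E|)%N by rewrite cardE index_mem mem_enum.
exists (fun i => i == index e (enum E)); rewrite /f find_map.
rewrite (_ : find _ _ = index e (enum E)) ?nth_index ?mem_enum//.
rewrite -[RHS](@index_uniq _ 0 _ (iota 0 #|E|)) ?size_iota ?iota_uniq//.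
by rewrite nth_iota.
Qed.

(** [s] and [t] are the source and target maps of a graph with edge set [E] and
    vertex set [P]. The edges entering [p] and those leaving [p] label two
    nonempty clopen sets; charting both by [bool^nat] gives a homeomorphism of
    the first onto the second, however different their numbers of edges. *)
Lemma graph_homeomorphism (R : realType) (T : pseudoMetricType R)
    (E P : finType) (s t : E -> P) (e0 : E) :
  [set: T] !=set0 -> cantor_like T ->
  (forall p, exists e, s e = p) -> (forall p, exists e, t e = p) ->
  exists (l : T -> E) (h : T -> T),
    [/\ locally_constant l, forall e, exists x, l x = e,
        homeomorphism_on [set: T] [set: T] h &
        forall x, s (l (h x)) = t (l x)].
Proof.
move=> T0 clT s_onto t_onto.
have [l [ll l_onto]] : exists l : T -> E,
    locally_constant l /\ forall e, exists x, l x = e.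
  have [u [v [cu cv uK vK]]] := cantor_like_homeomorphic T0 clT.
  have [f [lf f_onto]] := cantor_space_onto_finType e0.
  exists (f \o v); split; first exact: locally_constant_precomp.
  by move=> e; have [b <-] := f_onto e; exists (u b); rewrite /= uK.
have charts (r : E -> P) : (forall p, exists e, r e = p) ->
    exists uv : P -> (cantor_space -> T) * (T -> cantor_space),
      forall p, cantor_chart [set x | r (l x) = p] (uv p).1 (uv p).2.
  move=> r_onto.
  suff /choice[uv uvP] : forall p,
      exists uv : (cantor_space -> T) * (T -> cantor_space),
        cantor_chart [set x | r (l x) = p] uv.1 uv.2 by exists uv.
  move=> p; have [|u [v uvA]] :=
    @clopen_homeomorphic_cantor R T [set x | r (l x) = p] clT
      (locally_constant_fiber_clopen p (locally_constant_comp r ll)).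
    by have [e <-] := r_onto p; have [x <-] := l_onto e; exists x.
  by exists (u, v).
have [us usP] := charts s s_onto; have [ut utP] := charts t t_onto.
pose h x := (us (t (l x))).1 ((ut (t (l x))).2 x).
pose k x := (ut (s (l x))).1 ((us (s (l x))).2 x).
have sh x : s (l (h x)) = t (l x) by have [_ _ + _ _] := usP (t (l x)); apply.
have tk x : t (l (k x)) = s (l x) by have [_ _ + _ _] := utP (s (l x)); apply.
exists l, h; split => //; apply: (@homeomorphism_onT _ _ h k).
- apply: (glue_continuous (f := t \o l)
    (F := fun p x => (us p).1 ((ut p).2 x))).
    exact: locally_constant_comp.
  move=> p; have [_ cv _ _ _] := utP p; have [cu _ _ _ _] := usP p.
  by apply: within_comp cv ((continuous_subspace_setT _).1 cu) _.
- apply: (glue_continuous (f := s \o l)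
    (F := fun p x => (ut p).1 ((us p).2 x))).
    exact: locally_constant_comp.
  move=> p; have [_ cv _ _ _] := usP p; have [cu _ _ _ _] := utP p.
  by apply: within_comp cv ((continuous_subspace_setT _).1 cu) _.
- move=> x; rewrite {1}/k sh /h; have [_ _ _ -> _] := usP (t (l x)).
  by have [_ _ _ _ ->] := utP (t (l x)).
- move=> x; rewrite {1}/h tk /k; have [_ _ _ -> _] := utP (s (l x)).
  by have [_ _ _ _ ->] := usP (s (l x)).
Qed.

(** * Cantor sets in manifolds *)

Definition ctail (b : cantor_space) : cantor_space := fun i => b i.+1.

(** The sum of [2 b_i / 3^(i+1)] over [i < n], in Horner form. *)
Fixpoint ternary_sum (R : realType) (n : nat) (b : cantor_space) : R :=
  if n is m.+1 then ((b 0)%:R *+ 2 + ternary_sum R m (ctail b)) / 3 else 0.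

(** The ternary series is characterised by this functional equation and these
    bounds: together they say that the bits after the first [n] move the sum
    by at most [1/3^n] and that the first bit can be read off from it. *)
Lemma cantor_space_ternary (R : realType) :
  exists x : cantor_space -> R, [/\ forall b, 0 <= x b <= 1 &
    forall b, x b = ((b 0)%:R *+ 2 + x (ctail b)) / 3].
Proof.
have bnd n b : 0 <= ternary_sum R n b <= 1.
  elim: n b => [|n IH] b /=; first by rewrite lexx ler01.
  have /andP[] := IH (ctail b); case: (b 0) => /= ? ?; apply/andP; split; lra.
have inc b : {homo (ternary_sum R ^~ b) : m n / (m <= n)%N >-> m <= n}.
  apply: homo_leq => [//|/= ? ? ?|n]; first exact: le_trans.
  elim: n b => [|n IH] b; first by have /andP[] := bnd 1 b.
  by rewrite /= ler_pM2r// lerD2l.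
have cvg b : cvgn (ternary_sum R ^~ b).
  apply: nondecreasing_is_cvgn; first exact: inc.
  by exists 1 => _ [n _ <-]; have /andP[] := bnd n b.
exists (fun b => limn (ternary_sum R ^~ b)); split=> b.
  apply/andP; split.
    by apply: limr_ge => //; apply: nearW => n; have /andP[] := bnd n b.
  by apply: limr_le => //; apply: nearW => n; have /andP[] := bnd n b.
apply/cvg_lim => //; rewrite -cvg_shiftS /=.
apply: cvgMr_tmp; apply: cvgD; first exact: cvg_cst.
exact: cvg.
Qed.

Lemma cantor_space_embeds_in_itv (R : realType) :
  exists x : cantor_space -> R,
    [/\ continuous x, injective x & forall b, 0 <= x b <= 1].
Proof.
have [x [xb xE]] := cantor_space_ternary R.
have close n b c : (forall i, (i < n)%N -> b i = c i) ->
    `|x b - x c| <= 3^-1 ^+ n.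
  elim: n b c => [|n IH] b c bc.
    rewrite expr0 ler_norml; have /andP[? ?] := xb b.
    by have /andP[? ?] := xb c; apply/andP; split; lra.
  rewrite (xE b) (xE c) bc// -mulrBl opprD addrACA subrr add0r normrM exprSr.
  by rewrite (ger0_norm (x := 3^-1)) ?invr_ge0// ler_pM2r ?invr_gt0//;
    apply: IH => i ilt; exact: bc.
exists x; split=> //.
- move=> b; apply/cvgrPdist_lt => e e0.
  have /cvgrPdist_lt/(_ e e0)[n _ ne] :
      (3^-1 : R) ^+ n @[n --> \oo] --> (0 : R).
    by apply: cvg_expr; rewrite ger0_norm ?invr_ge0// invf_lt1// ltr1n.
  apply: filterS (cantor_space_prefix b n) => c cb.
  apply: le_lt_trans (close n b c _) _; first by move=> i /cb.
  by have := ne n (leqnn n); rewrite /= sub0r normrN ger0_norm.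
(* The two values of the first bit lead into the disjoint intervals [0, 1/3]
   and [2/3, 1]. *)
- have head b c : x b = x c -> b 0 = c 0 /\ x (ctail b) = x (ctail c).
    rewrite (xE b) (xE c); have /andP[? ?] := xb (ctail b).
    have /andP[? ?] := xb (ctail c).
    case: (b 0) (c 0) => [] [] /= bc; split => //;
      first [lra | exfalso; lra].
  move=> b c bc; apply/funext => i; elim: i b c bc => [|i IH] b c /head[//].
  by move=> _ /IH.
Qed.

(** In a chart at [p], the segment starting at the image of [p] in the direction
    [(1, ..., 1)] stays in the half-space; a short initial piece of it carries
    a copy of [bool^nat] and lifts into [N]. *)
Lemma cantor_space_embeds_in_manifold (R : realType) (n : nat)
    (M : topologicalType) (p : M) (N : set M) :
  (1 <= n)%N -> manifold R n M -> nbhs p N ->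
  exists e : cantor_space -> M,
    [/\ continuous e, injective e & forall b, N (e b)].
Proof.
case: n => // n _ [_ _ /(_ p)[U [V [phi [oU Up oV]]]]].
move=> [cphi [g [cg phiB gU phiK gK]]] pN.
have [x [cx injx xb]] := cantor_space_embeds_in_itv R.
pose line (t : R) : 'rV[R]_n.+1 := phi p + t *: const_mx 1.
have cline : continuous line.
  move=> t; apply: cvgD; first exact: cvg_cst.
  by apply: cvgZr_tmp; exact: cvg_id.
have [hp Vp] := phiB _ Up.
have half t : 0 <= t -> half_space (R := R) (n := n.+1) (line t).
  move=> t0 i i0; rewrite !mxE mulr1; apply: addr_ge0 => //; exact: hp.
have line0 : line 0 = phi p by rewrite /line scale0r addr0.
have near0 : \forall t \near (0 : R), V (line t) /\ (0 <= t -> N (g (line t))).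
  have cl0 := cline 0; rewrite /continuous_at line0 in cl0.
  have nV : nbhs (phi p) V by exact: open_nbhs_nbhs.
  move/subspace_continuousP : cg => /(_ (phi p) (conj hp Vp)).
  rewrite /from_subspace phiK// => /(_ N pN) nN.
  have lineV : \forall t \near (0 : R), V (line t) by exact: cl0 _ nV.
  have lineN : \forall t \near (0 : R),
    (half_space (R := R) (n := n.+1) `&` V) (line t) -> N (g (line t)).
    exact: cl0 _ nN.
  apply: filterS2 lineV lineN => t Vt Nt; split=> // t0.
  by apply: Nt; split => //; exact: half.
have [d /= d0 dP] := near0.
pose y b := d / 2 * x b.
have yP b : V (line (y b)) /\ N (g (line (y b))).
  have /andP[x0 x1] := xb b.
  have y0 : 0 <= y b by rewrite mulr_ge0// divr_ge0// ltW.
  have [|? H] := dP (y b); last by split=> //; exact: H.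
  rewrite /= sub0r normrN ger0_norm// /y; nra.
have arc b : (half_space (R := R) (n := n.+1) `&` V) (line (y b)).
  split; last by have [] := yP b.
  by apply: half; have /andP[x0 _] := xb b; rewrite mulr_ge0// divr_ge0// ltW.
exists (g \o (line \o y)); split.
- apply: (continuous_within_comp _ cg arc) => b.
  apply: continuous_comp; last exact: cline.
  by apply: cvgMl_tmp; exact: cx.
- move=> b c /= /(congr1 phi); rewrite !gK// => /addrI /rowP /(_ 0).
  rewrite !mxE !mulr1 => /mulfI bc; apply: injx; apply: bc.
  by rewrite mulf_neq0 ?gt_eqF// invr_gt0.
- by move=> b; have [] := yP b.
Qed.

(** * Finite models of a homeomorphism *)

(** Around each [x] one radius serves all nearby points; compactness makes it
    uniform. *)
Lemma lebesgue_number (R : realType) (T : pseudoMetricType R)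
    (Q : T -> T -> Prop) :
  compact [set: T] -> (forall x : T, \forall y \near x & z \near x, Q y z) ->
  exists2 d : R, 0 < d & forall y z, ball y d z -> Q y z.
Proof.
move=> /compact_near_coveringP cT locQ.
have [|d /= d0 dP] :=
  cT R ((0 : R)^'+) (fun d y => forall z, ball y d z -> Q y z).
  move=> x _; have [[U V] /= [/nbhs_ballP[e /= e0 eU]] ] := locQ x.
  move=> /nbhs_ballP[e' /= e'0 eV] UV.
  near=> y d => z yz.
  have de' : d <= e' / 2.
    by near: d; apply: nbhs_right_le; rewrite divr_gt0.
  apply: (UV (y, z)); split => /=.
    by apply: eU; near: y; exact: nbhsx_ballx.
  apply: eV; rewrite [e']splitr; apply: (@ball_triangle _ _ y).
    by near: y; apply: nbhsx_ballx; rewrite divr_gt0.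
  exact: le_ball de' _ yz.
exists (d / 2); first by rewrite divr_gt0.
move=> y z; apply: (dP (d / 2)) => //=; last by rewrite divr_gt0.
by rewrite sub0r normrN ger0_norm ?divr_ge0 ?ltW//; lra.
Unshelve. all: by end_near. Qed.

Lemma finite_net (R : realType) (M : metricType R) (d : R) :
  compact [set: M] -> [set: M] !=set0 -> 0 < d ->
  exists D : {fset M}, forall x, exists2 p, p \in D & mdist x p < d.
Proof.
move=> cM [x0 _] d0.
have cov : cover_compact [set: M].
  by have := cM; rewrite -(@compact_cover (pointed_at x0)).
have [||D _ Dcov] := cov M [set: M] (fun p => interior (ball p d)).
- by move=> p _; exact: open_interior.
- by move=> x _; exists x => //; exact: nbhsx_ballx.
exists D => x; have [p pD /interior_subset] := Dcov x I.
by rewrite ballEmdist /= metric_sym => px; exists p.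
Qed.

Lemma compact_uniformly_continuous (R : realType) (T M : metricType R)
    (f : T -> M) (d : R) :
  compact [set: T] -> continuous f -> 0 < d ->
  exists2 r : R, 0 < r & forall y z, mdist y z < r -> mdist (f y) (f z) < d.
Proof.
move=> cT cf d0.
have [|r r0 rP] := lebesgue_number (Q := fun y z => mdist (f y) (f z) < d) cT.
  move=> x.
  have fx : \forall y \near x, mdist (f x) (f y) < d / 2.
    have : nbhs (f x) (ball (f x) (d / 2)).
      by apply: nbhsx_ballx; rewrite divr_gt0.
    by rewrite ballEmdist => /(cf x).
  near=> y z; apply: le_lt_trans (metric_triangle _ (f x) _) _.
  rewrite [d]splitr metric_sym; apply: ltrD => /=; [near: y|near: z]; exact: fx.
by exists r => // y z yz; apply: rP; rewrite ballEmdist.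
Unshelve. all: by end_near. Qed.

(** The points of a finite net are the vertices. Each vertex [p] contributes two
    edges: one from [p] to a vertex near [f p], and one to [p] from a vertex
    near a preimage of [p]. This makes both the source map [s] and the target
    map [t] onto. *)
Lemma finite_model (R : realType) (M : metricType R) (f : M -> M) (d : R) :
  compact [set: M] -> [set: M] !=set0 ->
  homeomorphism_on [set: M] [set: M] f -> 0 < d ->
  exists (P E : finType) (pos : P -> M) (s t : E -> P),
    [/\ injective pos, forall x, exists p, mdist x (pos p) < d,
        (forall p, exists e, s e = p), (forall p, exists e, t e = p) &
        forall e, mdist (f (pos (s e))) (pos (t e)) < d].
Proof.
move=> cM M0 [/(continuous_subspace_setT f).2 cf [g [_ _ _ _ gK]]] d0.
have [r r0 fr] := compact_uniformly_continuous cM cf d0.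
have mr0 : 0 < Num.min d r by rewrite lt_min d0.
(* The net is also [r]-dense: a vertex within [r] of the preimage of [q] is sent
   within [d] of [q]. *)
have [D net] := finite_net cM M0 mr0.
have netP x : exists p : D, mdist x (val p) < Num.min d r.
  by have [p pD xp] := net x; exists [` pD]%fset.
have /choice[F FP] : forall p : D, exists q : D, mdist (f (val p)) (val q) < d.
  move=> p; have [q] := netP (f (val p)).
  by rewrite lt_min => /andP[? _]; exists q.
have /choice[G GP] : forall q : D, exists p : D, mdist (f (val p)) (val q) < d.
  move=> q; have [p] := netP (g (val q)).
  rewrite lt_min => /andP[_ qp]; exists p.
  by rewrite -[X in mdist _ X]gK// metric_sym; exact: fr.
(* [(p, true)] is the edge leaving [p] and [(p, false)] the edge entering it. *)
exists D, (D * bool)%type, val,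
  (fun e => if e.2 then e.1 else G e.1), (fun e => if e.2 then F e.1 else e.1).
split.
- by move=> p q /val_inj.
- by move=> x; have [p] := netP x; rewrite lt_min => /andP[? _]; exists p.
- by move=> p; exists (p, true).
- by move=> p; exists (p, false).
- by case=> p []; [exact: FP|exact: GP].
Qed.

(** * Perturbations by conjugates of the Special Homeomorphism *)

(** A locally constant map on a compact space does not see perturbations smaller
    than some Lebesgue number, so density of the conjugacy class is enough to
    agree with [h] exactly. *)
Lemma dense_conjugate_locally_constant (R : realType) (C : metricType R)
    (P : Type) (S h : C -> C) (l : C -> P) :
  compact [set: C] -> special_homeomorphism S ->
  homeomorphism_on [set: C] [set: C] h -> locally_constant l ->
  exists S' : C -> C, [/\ homeomorphism_on [set: C] [set: C] S',
    conjugate_on [set: C] [set: C] S' S & forall x, l (S' x) = l (h x)].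
Proof.
move=> cC [_ dense _] hh ll.
have [d d0 dP] : exists2 d : R, 0 < d & forall y z, ball y d z -> l y = l z.
  apply: lebesgue_number => // x.
  near=> y z => /=; transitivity (l x); first by near: y; exact: ll.
  by symmetry; near: z; exact: ll.
have [|S' [[hS' cS'] close]] :=
  dense h hh [set k | forall x, ball (h x) d (k x)].
  apply/uniform_nbhs; exists [set xy | ball xy.1 d xy.2].
  by split; [exact: (@entourage_ball _ _ (PosNum d0))|move=> k hk x; exact: hk].
by exists S'; split => // x; rewrite (dP _ _ (close x)).
Unshelve. all: by end_near. Qed.

(** * Embedding a Cantor space near a finite set *)

(** The fibre of [l] over [p] is sent into a copy of [bool^nat] within distance
    [r] of [pos p], where [r] is so small that copies for distinct [p] are
    disjoint. *)
Lemma cantor_embedding_near (R : realType) (n : nat) (M : metricType R)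
    (P : finType) (pos : P -> M) (T : pseudoMetricType R) (l : T -> P) (d : R) :
  (1 <= n)%N -> manifold R n M -> injective pos ->
  [set: T] !=set0 -> cantor_like T -> locally_constant l -> 0 < d ->
  exists i : T -> M,
    [/\ continuous i, injective i & forall x, mdist (pos (l x)) (i x) < d].
Proof.
move=> n1 mM injpos T0 clT ll d0.
have [u [v [cu cv uK vK]]] := cantor_like_homeomorphic T0 clT.
have [r [r0 rd sep]] : exists r : R, [/\ 0 < r, r <= d &
    forall p q, p != q -> r + r <= mdist (pos p) (pos q)].
  have sep1 p q : \forall r \near (0 : R)^'+,
      p != q -> r + r <= mdist (pos p) (pos q).
    have [->|pq] := eqVneq p q; first by apply: nearW.
    have pos2 : 0 < mdist (pos p) (pos q) / 2.
      by rewrite divr_gt0// mdist_gt0; apply: contra_neq pq => /injpos.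
    have : \forall r \near (0 : R)^'+, r <= mdist (pos p) (pos q) / 2.
      exact: nbhs_right_le.
    by apply: filterS => r rpq _; rewrite [leRHS]splitr lerD.
  have sepP : \forall r \near (0 : R)^'+,
      forall p q, p != q -> r + r <= mdist (pos p) (pos q).
    by apply: filter_forall => p; apply: filter_forall => q; exact: sep1.
  near (0 : R)^'+ => r; exists r; split=> //.
    by near: r; exact: nbhs_right_le.
  by near: r; exact: sepP.
have /choice[e eP] : forall p, exists e : cantor_space -> M,
    [/\ continuous e, injective e & forall b, mdist (pos p) (e b) < r].
  move=> p; apply: (@cantor_space_embeds_in_manifold R n M (pos p)
    [set x | mdist (pos p) x < r]) => //.
  by apply/nbhs_ballP; exists r => // x; rewrite ballEmdist.
exists (fun x => e (l x) (v x)); split.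
- apply: (glue_continuous (F := fun p x => e p (v x)) ll) => p.
  apply: continuous_subspaceT => x; apply: continuous_comp; first exact: cv.
  by have [ce _ _] := eP p; exact: ce.
- move=> x y; have [lxy|lxy] := eqVneq (l x) (l y).
    by have [_ inje _] := eP (l x); rewrite -lxy => /inje/(can_inj vK).
  have [_ _ ex] := eP (l x); have [_ _ ey] := eP (l y) => exy.
  have := sep _ _ lxy; rewrite leNgt => /negP; case.
  apply: le_lt_trans (metric_triangle _ (e (l x) (v x)) _) _.
  by apply: ltrD; [exact: ex|rewrite exy metric_sym].
- by move=> x; have [_ _ ex] := eP (l x); apply: lt_le_trans (ex _) rd.
Unshelve. all: by end_near. Qed.

(** By compactness [i] is a closed map. *)
Lemma embedding_homeomorphism (T U : topologicalType) (i : T -> U) :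
  [set: T] !=set0 -> compact [set: T] -> hausdorff_space U ->
  continuous i -> injective i ->
  exists j : U -> T, {within range i, continuous j} /\ cancel i j.
Proof.
move=> [x0 _] cT hU ci inji.
have [j jP] : exists j : U -> T, cancel i j.
  suff /choice[j jP] : forall y, exists x, range i y -> i x = y.
    by exists j => x; apply/inji/jP; exists x.
  move=> y; have [[x _ <-]|nr] := pselect (range i y); first by exists x.
  by exists x0.
exists j; split => //; apply/continuous_closedP => A clA.
apply/closed_subspaceP; exists (i @` A).
  apply: compact_closed => //; apply: continuous_compact.
    exact: continuous_subspaceT.
  exact: subclosed_compact clA cT _.
apply/seteqP; split => [_ [[x Ax <-] ri]|y [+ [x _ xy]]].
  by split; [have : A (j (i x)) by rewrite jP|exists x].
rewrite -xy => Ay; split; last by exists x.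
by exists x => //; have : A (j (i x)) := Ay; rewrite jP.
Qed.

Lemma cantor_set_embedding (T U : topologicalType) (i : T -> U) (j : U -> T) :
  hausdorff_space U -> continuous i -> {within range i, continuous j} ->
  cancel i j -> cantor_set [set: T] -> cantor_set (range i).
Proof.
move=> hU ci cj iK [[x0 _] cT pT tdT].
have cR : compact (range i).
  by apply: continuous_compact cT; exact: continuous_subspaceT.
split=> //; first by exists (i x0); exists x0.
- have clR := compact_closed hU cR; split=> //.
  apply/seteqP; split => [y yl|_ [x _ <-] N Nx].
    by apply: clR; exact: subset_limit_point.
  have : limit_point [set: T] x by rewrite pT.2.
  move=> /(_ _ (ci _ _ Nx))[y [yx _ Ny]]; exists (i y); split => //.
  by rewrite (can_eq iK).
- move=> _ [x _ <-]; apply/seteqP; split; last first.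
    by move=> _ ->; apply: connected_component_refl; exists x.
  move=> y [B [Bx BR conB] By].
  have jB : connected (j @` B).
    apply: connected_continuous_connected => //.
    exact: continuous_subspaceW cj.
  have [y' _ yy'] := BR _ By; rewrite -yy' in By *.
  have : connected_component [set: T] x y'.
    exists (j @` B); last by exists (i y').
    by split => //; exists (i x).
  by rewrite tdT// => ->.
Qed.

(** * Approximation by the Special Homeomorphism *)

Unset Implicit Arguments.

Theorem corollary2p21 (R : realType)
  (C : metricType R) (S : C -> C)
  (hC : cantor_set [set: C]) (hS : special_homeomorphism S)
  (n : nat) (hn : (1 <= n)%N)
  (M : metricType R) (hM : manifold R n M)
  (hM0 : [set: M] !=set0) (hMc : compact [set: M])
  (f : M -> M) (hf : homeomorphism_on [set: M] [set: M] f)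
  (eps : R) (heps : 0 < eps) :
  exists (K : set M) (g : M -> M),
    [/\ cantor_set K, eps_dense eps K, homeomorphism_on K K g,
        conjugate_on K [set: C] g S & dist_C0 K g f < eps].
Proof.
have [C0 cC _ _] := hC.
have clC : cantor_like C := cantor_set_cantor_like (@metric_hausdorff _ C) hC.
(* The distance from [g] to [f] splits into three errors below [d]; a quarter
   leaves room for the supremum, which need not be strictly below [3 * d]. *)
pose d := eps / 4; have d0 : 0 < d by rewrite divr_gt0.
have [P [E [pos [s [t [injpos net s_onto t_onto edge]]]]]] :=
  finite_model hMc hM0 hf d0.
have [[m0 _] [c0 _]] := (hM0, C0).
have [p0 _] := net m0; have [e0 _] := s_onto p0.
have [l [h [ll l_onto hh lh]]] := graph_homeomorphism e0 C0 clC s_onto t_onto.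
have [S' [hS' conjS' lS']] := dense_conjugate_locally_constant cC hS hh ll.
have [r r0 fr] := compact_uniformly_continuous hMc
  ((continuous_subspace_setT f).2 hf.1) d0.
have mr0 : 0 < Num.min d r by rewrite lt_min d0.
have [i [ci inji near_i]] := cantor_embedding_near hn hM injpos C0 clC
  (locally_constant_comp s ll) mr0.
have near_d x : mdist (pos (s (l x))) (i x) < d.
  by have := near_i x; rewrite lt_min => /andP[].
have hausM : hausdorff_space M := @metric_hausdorff _ M.
have [j [cj iK]] := embedding_homeomorphism C0 cC hausM ci inji.
have jK y : range i y -> i (j y) = y by move=> [x _ <-]; rewrite iK.
have hj : homeomorphism_on (range i) [set: C] j.
  split=> //; exists i; split => //; exact/(continuous_subspace_setT i).
have hi : homeomorphism_on [set: C] (range i) i.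
  by split; [exact/(continuous_subspace_setT i)|exists j].
exists (range i), (i \o S' \o j); split.
- exact: cantor_set_embedding cj iK hC.
- move=> x; have [p xp] := net x; have [e se] := s_onto p.
  have [c lc] := l_onto e; exists (i c); first by exists c.
  apply: le_lt_trans (metric_triangle _ (pos p) _) _.
  by have := near_d c; rewrite lc se /d in xp *; lra.
- exact: homeomorphism_on_comp hj (homeomorphism_on_comp hS' hi).
- have [phi [hphi phiS]] := conjS'.
  exists (phi \o j); split; first exact: homeomorphism_on_comp hj hphi.
  by move=> y _ /=; rewrite iK phiS.
- apply: (@le_lt_trans _ _ (3 * d)); last by rewrite /d; lra.
  apply: ge_sup.
    exists (mdist ((i \o S' \o j) (i c0)) (f (i c0))).
    by exists (i c0) => //; exists c0.
  move=> _ [_ [c _ <-] <-] /=; rewrite iK.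
  set q := pos (s (l (S' c))); set p := pos (s (l c)).
  have iq : mdist (i (S' c)) q < d by rewrite metric_sym; exact: near_d.
  have qp : mdist q (f p) < d by rewrite metric_sym /q lS' lh; exact: edge.
  have pi : mdist (f p) (f (i c)) < d.
    by apply: fr; have := near_i c; rewrite lt_min => /andP[].
  have := metric_triangle (i (S' c)) q (f (i c)).
  have := metric_triangle q (f p) (f (i c)).
  lra.
Qed.
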